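(* Let $N>0$ be an integer and let $f:\mathbb{Z}\to\mathbb{C}$ be a periodic discrete signal with period $N$. For $n,k\in\mathbb{Z}$ put $x_n(k)=e^{jn(2\pi/N)k}$ (for fixed $n$, a discrete signal in the variable $k$) and $\bar x_k(n)=e^{-jk(2\pi/N)n}$ (for fixed $k$, a discrete signal in the variable $n$); both are periodic with period $N$. Define $$F(n)=\sum_{m=0}^{N-1}f(m)e^{-jm(2\pi/N)n},\qquad n\in\mathbb{Z}.$$ Then $F$ is periodic with period $N$, i.e. $F(n+N)=F(n)$ for all $n\in\mathbb{Z}$, and for all $n,k\in\mathbb{Z}$, $$(f\circledast x_n)(k)=F(n)\,x_n(k),$$ $$(F\circledast \bar x_k)(n)=N f(k)\,\bar x_k(n).$$
   Context: Here $j$ is the imaginary unit. A discrete signal is a function $\mathbb{Z}\to\mathbb{C}$; it is periodic with period $N$ if $g(k+N)=g(k)$ for all $k\in\mathbb{Z}$. For discrete signals $f,g$ with the same period $N$, the periodic convolution is $(f\circledast g)(k)=\sum_{n=0}^{N-1}f(n)g(k-n)$. The signal $F$ is called the Discrete Fourier Transform (DFT) of $f$. *)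

(* Defs.v *)
From mathcomp Require Import all_boot all_order all_algebra.
From mathcomp Require Import complex.
From mathcomp Require Import reals sequences trigo.

Set Implicit Arguments.
Unset Strict Implicit.
Unset Printing Implicit Defensive.

Import Order.TTheory GRing.Theory Num.Theory.

Local Open Scope ring_scope.
Local Open Scope complex_scope.

(* Discrete signals are functions int -> R[i], with R an arbitrary model of the
   real numbers. *)

(* e^(a + ib) = e^a (cos b + i sin b); the libraries only have the real
   exponential. *)
Definition cexp (R : realType) (z : R[i]) : R[i] :=
  let: a +i* b := z in (expR a)%:C * (cos b +i* sin b).

(* Only meaningful as "periodic convolution" when f and g have period N. *)
Definition pconv (R : realType) (N : nat) (f g : int -> R[i]) : int -> R[i] :=
  fun k => \sum_(0 <= n < N) f n%:Z * g (k - n%:Z).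

Definition expsig (R : realType) (N : nat) (n : int) : int -> R[i] :=
  fun k => cexp ('i%C * n%:~R * (2 * pi / N%:R)%:C * k%:~R).

Definition expsig_bar (R : realType) (N : nat) (k : int) : int -> R[i] :=
  fun n => cexp (- 'i%C * k%:~R * (2 * pi / N%:R)%:C * n%:~R).

Definition dft (R : realType) (N : nat) (f : int -> R[i]) : int -> R[i] :=
  fun n => \sum_(0 <= m < N)
    f m%:Z * cexp (- 'i%C * m%:~R * (2 * pi / N%:R)%:C * n%:~R).

Arguments expsig : clear implicits.
Arguments expsig_bar : clear implicits.

(* Main.v *)
Require Import Defs.
From mathcomp Require Import all_boot all_order all_algebra.
From mathcomp Require Import complex ring.
From mathcomp Require Import reals sequences exp trigo.

(** Write [zeta d] for exp(2 pi i d / N). Since x_n(k) = zeta (n k) and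
    bar x_k(n) = zeta (- k n), everything reduces to the additive character
    [zeta] of the integers, which is trivial on multiples of N: this gives all
    the periodicity claims at once.

    The first convolution identity is purely formal, because
    x_n(k - m) = x_n(k) zeta (- n m) and the factor x_n(k) leaves the sum: the
    exponentials are eigenvectors of convolution by f ([pconv_expsig]).

    For the second one, expanding F and exchanging the two sums leaves
    bar x_k(n) times the sum over m of
    f(m) * (sum over p of zeta ((k - m) p)).
    By orthogonality of characters ([sum_zeta]) the inner sum is N when N
    divides k - m and 0 otherwise, so only the residue m of k modulo N
    contributes, and f(m) = f(k) by periodicity. Orthogonality rests on the
    kernel of [zeta] being exactly N Z ([zeta_eq1]), which is where the
    geometry of the circle enters: exp(i x) <> 1 for 0 < x < 2 pi. *)

Set Implicit Arguments.
Unset Strict Implicit.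
Unset Printing Implicit Defensive.

Import Order.TTheory GRing.Theory Num.Theory.

Local Open Scope ring_scope.
Local Open Scope complex_scope.

Definition cis (R : realType) (x : R) : R[i] := cos x +i* sin x.

Lemma cexp_im (R : realType) (x : R) : cexp (0 +i* x) = cis x.
Proof. by rewrite /cexp expR0 mul1r. Qed.

Lemma cisD (R : realType) (x y : R) : cis (x + y) = cis x * cis y.
Proof. by rewrite /cis cosD sinD [X in _ +i* X]addrC. Qed.

Lemma cis0 (R : realType) : cis (0 : R) = 1.
Proof. by rewrite /cis cos0 sin0. Qed.

Lemma cis2pi (R : realType) : cis (2 * pi : R) = 1.
Proof. by rewrite /cis mulr_natl cos2pi sin2pi. Qed.

(** The cosine alone decides: 1 - cos x = 2 sin^2 (x / 2), and x / 2 lies in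
    (0, pi), where the sine is positive. *)
Lemma cis_neq1 (R : realType) (x : R) : 0 < x < 2 * pi -> cis x != 1.
Proof.
move=> /andP[x0 x2pi]; apply/eqP => -[cosx1 _].
have : 0 < sin (x / 2).
  by apply: sin_gt0_pi; rewrite divr_gt0 //= ltr_pdivrMr // mulrC.
have /eqP : sin (x / 2) ^+ 2 *+ 2 = 0.
  have -> : sin (x / 2) ^+ 2 *+ 2 = 1 - cos (x / 2 *+ 2).
    by rewrite cos_mulr2n cos2sin2; ring.
  by rewrite -mulr_natr divfK ?pnatr_eq0 // cosx1 subrr.
by rewrite mulrn_eq0 /= sqrf_eq0 => /eqP ->; rewrite ltxx.
Qed.

Definition zeta (R : realType) (N : nat) (d : int) : R[i] :=
  cis (2 * pi / N%:R * d%:~R).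

Arguments zeta : clear implicits.

Lemma zetaD (R : realType) (N : nat) (c d : int) :
  zeta R N (c + d) = zeta R N c * zeta R N d.
Proof. by rewrite /zeta rmorphD mulrDr cisD. Qed.

Lemma zeta0 (R : realType) (N : nat) : zeta R N 0 = 1.
Proof. by rewrite /zeta mulr0 cis0. Qed.

Lemma zetaMn (R : realType) (N p : nat) (d : int) :
  zeta R N (d * p%:Z) = zeta R N d ^+ p.
Proof.
elim: p => [|p IHp]; first by rewrite mulr0 zeta0.
by rewrite intS mulrDr mulr1 zetaD IHp exprS.
Qed.

Lemma zeta_period (R : realType) (N : nat) : (0 < N)%N -> zeta R N N%:Z = 1.
Proof. by move=> N0; rewrite /zeta divfK ?cis2pi // pnatr_eq0 -lt0n. Qed.

Lemma zeta_dvd (R : realType) (N : nat) (d : int) : (0 < N)%N ->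
  (N%:Z %| d)%Z -> zeta R N d = 1.
Proof.
move=> N0 /dvdzP[q ->].
have zetaN (n : nat) : zeta R N (n%:Z * N%:Z) = 1.
  by rewrite mulrC zetaMn zeta_period // expr1n.
case: q => n; first exact: zetaN.
by rewrite NegzE -[LHS]mulr1 -(zetaN n.+1) -zetaD mulNr addNr zeta0.
Qed.

Lemma zetaDl (R : realType) (N : nat) (c d : int) : (0 < N)%N ->
  (N%:Z %| d)%Z -> zeta R N (c + d) = zeta R N c.
Proof. by move=> N0 Nd; rewrite zetaD (zeta_dvd _ N0 Nd) mulr1. Qed.

(** Modulo N, d may be replaced by its remainder r; if r is nonzero, the angle
    2 pi r / N lies strictly between 0 and 2 pi. *)
Lemma zeta_eq1 (R : realType) (N : nat) (d : int) : (0 < N)%N ->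
  (zeta R N d == 1) = (N%:Z %| d)%Z.
Proof.
move=> N0; apply/idP/idP => [|Nd]; last by rewrite zeta_dvd.
apply: contraLR => /dvdz_mod0P/eqP dN0.
rewrite (divz_eq d N%:Z) addrC zetaDl ?dvdz_mull //.
have NR0 : 0 < N%:R :> R by rewrite ltr0n.
have r0 : 0 < (d %% N%:Z)%Z by rewrite lt0r dN0 modz_ge0 // eqz_nat -lt0n.
have rN : (d %% N%:Z)%Z < N%:Z by rewrite ltz_pmod.
apply: cis_neq1; rewrite mulr_gt0 ?divr_gt0 ?mulr_gt0 ?pi_gt0 ?ltr0z //=.
rewrite mulrAC ltr_pdivrMr // ltr_pM2l ?mulr_gt0 ?pi_gt0 //.
by rewrite -[ltRHS]/(N%:Z%:~R) ltr_int.
Qed.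

(** Orthogonality of the characters of Z/N: the summands are the powers of the
    N-th root of unity z = zeta d, and (z - 1) (1 + z + ... + z^(N-1)) =
    z^N - 1 = 0 kills the sum unless z = 1. *)
Lemma sum_zeta (R : realType) (N : nat) (d : int) : (0 < N)%N ->
  \sum_(0 <= p < N) zeta R N (d * p%:Z) = if (N%:Z %| d)%Z then N%:R else 0.
Proof.
move=> N0; rewrite big_mkord; under eq_bigr do rewrite zetaMn.
rewrite -(zeta_eq1 R) //; case: ifPn => [/eqP ->|zd1].
  by under eq_bigr do rewrite expr1n; rewrite sumr_const card_ord.
apply/(mulfI (x := zeta R N d - 1)); first by rewrite subr_eq0.
by rewrite mulr0 -subrX1 -zetaMn zeta_dvd ?dvdz_mull // subrr.
Qed.

Lemma periodic_modz (V : zmodType) (N : nat) (f : int -> V) (k : int) :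
  periodic f N%:Z -> f (k %% N%:Z)%Z = f k.
Proof.
move=> hf; have hfn n x : f (x + n%:Z * N%:Z) = f x.
  by rewrite mulrC -(natz n) mulr_natr periodicn.
(* The available shifts are by natural multiples of N, so for a negative
   quotient the right-hand side is shifted forward. *)
rewrite {2}(divz_eq k N%:Z) addrC; case: (k %/ N%:Z)%Z => n; first by rewrite hfn.
by rewrite NegzE mulNr -[RHS](hfn n.+1) subrK.
Qed.

Lemma intr_complexE (R : realType) (d : int) : d%:~R = d%:~R +i* 0 :> R[i].
Proof. by rewrite -(rmorph_int (real_complex R)). Qed.

Lemma expsigE (R : realType) (N : nat) (n k : int) :
  expsig R N n k = zeta R N (n * k).
Proof.
rewrite /expsig /zeta -cexp_im; congr cexp.
rewrite !intr_complexE /=.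
apply/eqP; rewrite eq_complex /=; rewrite intrM.
by apply/andP; split; apply/eqP; ring.
Qed.

Lemma expsig_barE (R : realType) (N : nat) (k n : int) :
  expsig_bar R N k n = zeta R N (- (k * n)).
Proof.
rewrite /expsig_bar /zeta -cexp_im; congr cexp.
rewrite !intr_complexE /=.
apply/eqP; rewrite eq_complex /=; rewrite mulrNz intrM.
by apply/andP; split; apply/eqP; ring.
Qed.

Lemma dftE (R : realType) (N : nat) (f : int -> R[i]) (n : int) :
  dft N f n = \sum_(0 <= m < N) f m%:Z * zeta R N (- (m%:Z * n)).
Proof. by apply: eq_bigr => m _; rewrite -expsig_barE. Qed.

Lemma pconv_expsig (R : realType) (N : nat) (f : int -> R[i]) (n k : int) :
  pconv N f (expsig R N n) k = dft N f n * expsig R N n k.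
Proof.
rewrite /pconv dftE expsigE mulr_suml; apply: eq_bigr => m _.
by rewrite expsigE -mulrA -zetaD; congr (_ * zeta R N _); ring.
Qed.

(** Fourier inversion, with the summand of the inverse transform translated to
    the point n: the sum over frequencies p selects the m congruent to k. *)
Lemma pconv_dft_expsig_bar (R : realType) (N : nat) (f : int -> R[i])
    (n k : int) : (0 < N)%N -> periodic f N%:Z ->
  pconv N (dft N f) (expsig_bar R N k) n = N%:R * f k * expsig_bar R N k n.
Proof.
move=> N0 hf.
transitivity (\sum_(0 <= m < N) f m%:Z * zeta R N (- (k * n)) *
    \sum_(0 <= p < N) zeta R N ((k - m%:Z) * p%:Z)).
  under [RHS]eq_bigr do rewrite mulr_sumr.
  rewrite exchange_big /=; apply: eq_bigr => p _.
  rewrite dftE expsig_barE mulr_suml; apply: eq_bigr => m _.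
  by rewrite -!mulrA -!zetaD; congr (_ * zeta R N _); ring.
(* The only index m < N congruent to k is the remainder of k modulo N. *)
have k0 : 0 <= (k %% N%:Z)%Z by rewrite modz_ge0 // eqz_nat -lt0n.
have kN : (`|(k %% N%:Z)%Z| < N)%N by rewrite -ltz_nat gez0_abs // ltz_pmod.
under eq_bigr do rewrite sum_zeta // -eqz_mod_dvd.
rewrite big_mkord (bigD1 (Ordinal kN)) //= big1 => [|m mk].
  rewrite gez0_abs // modz_mod eqxx periodic_modz // expsig_barE addr0.
  by rewrite mulrC mulrA.
rewrite (modz_small (m := m%:Z)) ?ltz_nat ?ltn_ord //.
case: eqP => [km|_]; last by rewrite mulr0.
by case/eqP: mk; apply: val_inj; rewrite /= km.
Qed.

Theorem proposition3p2 (R : realType) (N : nat) (hN : (0 < N)%N)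
    (f : int -> R[i]) (hf : periodic f N%:Z) :
  (forall n : int, periodic (expsig R N n) N%:Z) /\
  (forall k : int, periodic (expsig_bar R N k) N%:Z) /\
  periodic (dft N f) N%:Z /\
  (forall n k : int,
     pconv N f (expsig R N n) k = dft N f n * expsig R N n k) /\
  (forall n k : int,
     pconv N (dft N f) (expsig_bar R N k) n =
       N%:R * f k * expsig_bar R N k n).
Proof.
split; [|split; [|split; [|split]]].
- by move=> n k; rewrite !expsigE mulrDr zetaDl ?dvdz_mull.
- by move=> k n; rewrite !expsig_barE -mulNr mulrDr zetaDl ?dvdz_mull ?mulNr.
- move=> n; rewrite !dftE; apply: eq_bigr => m _.
  by rewrite -mulNr mulrDr zetaDl ?dvdz_mull ?mulNr.
- by move=> n k; apply: pconv_expsig.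
- by move=> n k; apply: pconv_dft_expsig_bar.
Qed.
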